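(* Let $(V,g)$ be a Euclidean real vector space of dimension $n$ and let $h$ be a bilinear form on $V$. For $0\le k\le n-1$, the trace of $t_k(h)=\frac{1}{k!\,(n-1-k)!}*\bigl(g^{n-1-k}h^k\bigr)$ is $$\mathrm c\,t_k(h)=(n-k)\,s_k(h),$$ where $\mathrm c$ is the contraction map and $s_k(h)$ are the characteristic coefficients of $h$.
   Context: Let $(V,g)$ be a Euclidean real vector space of dimension $n$. A $(p,q)$ double form is an element of $\mathcal D^{p,q}=\Lambda^pV^*\otimes\Lambda^qV^*$, identified with a bilinear form $\Lambda^pV\times\Lambda^qV\to\mathbb R$. Exterior product: $(\theta_1\otimes\theta_2)(\theta_3\otimes\theta_4)=(\theta_1\wedge\theta_3)\otimes(\theta_2\wedge\theta_4)$, extended bilinearly; products and powers in the claim are exterior products, with zeroth power $1$; bilinear forms such as $g,h$ are regarded as $(1,1)$ double forms. Double Hodge star: for a $(p,p)$ double form $\omega$, $*\omega$ is the $(n-p,n-p)$ double form $*\omega(u,v)=\omega( *u,*v)$, with $*$ on the right the usual Hodge star $\Lambda^{n-p}V\to\Lambda^{p}V$ for some chosen orientation (the result does not depend on it). The contraction of a bilinear form $b$ is $\mathrm c\,b=\sum_i b(e_i,e_i)$ for any orthonormal basis $(e_i)$. The invariants $s_k(h)$, $0\le k\le n$, are defined by $\det(\bar h-\lambda I)=\sum_{k=0}^n(-1)^{n-k}s_k(h)\lambda^{n-k}$, where $\bar h$ is the linear operator on $V$ corresponding to $h$ via $g$ (with matrix $(h(e_i,e_j))$, up to transposition, in an orthonormal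 basis); $s_0(h)=1$. *)

(* Defs.v *)
From HB Require Import structures.
From mathcomp Require Import all_boot all_order all_fingroup all_algebra.
From mathcomp Require Import reals.

Set Implicit Arguments.
Unset Strict Implicit.
Unset Printing Implicit Defensive.

Import Order.TTheory GRing.Theory Num.Theory.
Local Open Scope ring_scope.

Section AlternatingForms.
Variables (R : realType) (V : vectType R).

Definition upd p (x : {ffun 'I_p -> V}) (i : 'I_p) (v : V) : {ffun 'I_p -> V} :=
  [ffun j => if j == i then v else x j].

(* p-linear alternating maps on V^p, i.e. the elements of Lambda^p V^*. *)
Definition alternating p (f : {ffun 'I_p -> V} -> R) : Prop :=
  (forall x i a u v, f (upd x i (a *: u + v)) = a * f (upd x i u) + f (upd x i v))
  /\ (forall (x : {ffun 'I_p -> V}) i j, i != j -> x i = x j -> f x = 0).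

Record altform p := AltForm {
  altform_fun :> {ffun 'I_p -> V} -> R;
  altformP : alternating altform_fun }.

Definition permf p (x : {ffun 'I_p -> V}) (s : 'S_p) : {ffun 'I_p -> V} :=
  [ffun i => x (s i)].

Definition left_args p r (x : {ffun 'I_(p + r) -> V}) : {ffun 'I_p -> V} :=
  [ffun i => x (lshift r i)].

Definition right_args p r (x : {ffun 'I_(p + r) -> V}) : {ffun 'I_r -> V} :=
  [ffun i => x (rshift p i)].

Definition join_args p r (x : {ffun 'I_p -> V}) (z : {ffun 'I_r -> V}) :
    {ffun 'I_(p + r) -> V} :=
  [ffun i => match split i with inl a => x a | inr b => z b end].

(* Normalised so that, for linear forms,
   (a_1 /\ ... /\ a_p)(x_1, ..., x_p) = det (a_i x_j). *)
Definition wedge_fun p r (f : {ffun 'I_p -> V} -> R) (g : {ffun 'I_r -> V} -> R)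
    (x : {ffun 'I_(p + r) -> V}) : R :=
  ((p`! * r`!)%:R)^-1 *
  \sum_(s : 'S_(p + r))
     (-1) ^+ s * (f (left_args (permf x s)) * g (right_args (permf x s))).

Lemma permf_upd p (x : {ffun 'I_p -> V}) i v (s : 'S_p) :
  permf (upd x i v) s = upd (permf x s) (s^-1 i)%g v.
Proof.
apply/ffunP=> j; rewrite !ffunE.
by rewrite -(inj_eq (@perm_inj _ s) j) permKV.
Qed.

Lemma left_updl p r (x : {ffun 'I_(p + r) -> V}) i v :
  left_args (upd x (lshift r i) v) = upd (left_args x) i v.
Proof. by apply/ffunP=> j; rewrite !ffunE (inj_eq (@lshift_inj _ _)). Qed.

Lemma left_updr p r (x : {ffun 'I_(p + r) -> V}) i v :
  left_args (upd x (rshift p i) v) = left_args x.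
Proof. by apply/ffunP=> j; rewrite !ffunE eq_lrshift. Qed.

Lemma right_updr p r (x : {ffun 'I_(p + r) -> V}) i v :
  right_args (upd x (rshift p i) v) = upd (right_args x) i v.
Proof. by apply/ffunP=> j; rewrite !ffunE (inj_eq (@rshift_inj _ _)). Qed.

Lemma right_updl p r (x : {ffun 'I_(p + r) -> V}) i v :
  right_args (upd x (lshift r i) v) = right_args x.
Proof. by apply/ffunP=> j; rewrite !ffunE eq_rlshift. Qed.

Lemma wedge_alternating p r (f : {ffun 'I_p -> V} -> R)
    (g : {ffun 'I_r -> V} -> R) :
  alternating f -> alternating g -> alternating (wedge_fun f g).
Proof.
move=> [fl fa] [gl ga]; split=> [x i a u v|x i j ij xij].
  rewrite /wedge_fun mulrCA -mulrDr; congr (_ * _).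
  rewrite mulr_sumr -big_split /=.
  apply: eq_bigr => s _; rewrite [a * _]mulrCA -mulrDr; congr (_ * _).
  rewrite !permf_upd; case: (split_ordP (s^-1 i)%g) => c ->.
    by rewrite !left_updl !right_updl fl mulrDl mulrA.
  by rewrite !left_updr !right_updr gl mulrDr mulrCA.
rewrite /wedge_fun; set S := (X in _ * X).
suff -> : S = 0 by rewrite mulr0.
have permx s : permf x (s * tperm i j)%g = permf x s.
  apply/ffunP=> c; rewrite !ffunE permM.
  by case: tpermP => [->|->|//]; rewrite xij.
have : S = - S.
  rewrite {1}/S (reindex_inj (@mulIg _ (tperm i j))) /= -sumrN.
  apply: eq_bigr => s _; rewrite permx odd_permM odd_tperm ij addbT.
  by rewrite -mulNr; congr (_ * _); case: (s : bool); rewrite ?expr0 ?expr1 ?opprK.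
by move=> /eqP; rewrite -addr_eq0 -mulr2n mulrn_eq0 => /eqP.
Qed.

Definition wedge p r (f : altform p) (g : altform r) : altform (p + r) :=
  AltForm (wedge_alternating (altformP f) (altformP g)).

Lemma alternating_sum p (I : Type) (r : seq I) (P : pred I) (c : I -> R)
    (f : I -> {ffun 'I_p -> V} -> R) :
  (forall i, alternating (f i)) ->
  alternating (fun x => \sum_(i <- r | P i) c i * f i x).
Proof.
move=> fA; split=> [x i a u v|x i j ij xij].
  rewrite mulr_sumr -big_split /=; apply: eq_bigr => k _.
  by rewrite (fA k).1 mulrDr mulrCA.
by rewrite big1 // => k _; rewrite ((fA k).2 x i j) // mulr0.
Qed.

Lemma alternating_scale p a (f : {ffun 'I_p -> V} -> R) :
  alternating f -> alternating (fun x => a * f x).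
Proof.
move=> [fl fa]; split=> [x i b u v|x i j ij xij].
  by rewrite fl mulrDr mulrCA.
by rewrite (fa x i j) // mulr0.
Qed.

Lemma alternating_ext p (f f' : {ffun 'I_p -> V} -> R) :
  f =1 f' -> alternating f -> alternating f'.
Proof.
move=> ff' [fl fa]; split=> [x i a u v|x i j ij xij].
  by rewrite -!ff' fl.
by rewrite -ff' (fa x i j).
Qed.

Lemma alternating_linear (f : V -> R) :
  scalar f -> alternating (fun x : {ffun 'I_1 -> V} => f (x ord0)).
Proof.
move=> fl; split=> [x i a u v|x i j]; last by rewrite (ord1 i) (ord1 j) eqxx.
by rewrite !ffunE (ord1 i) eqxx fl.
Qed.

End AlternatingForms.

Section DoubleForms.
Variables (R : realType) (V : vectType R).

(* A bilinear form Lambda^p V x Lambda^q V -> R is given by its values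
   omega (x_1 /\ ... /\ x_p, y_1 /\ ... /\ y_q) on decomposable arguments:
   a map that is multilinear and alternating in x and in y. *)
Record dform p q := DForm {
  dform_fun :> {ffun 'I_p -> V} -> {ffun 'I_q -> V} -> R;
  dform_altl : forall y, alternating (fun x => dform_fun x y);
  dform_altr : forall x, alternating (dform_fun x) }.

Definition dtensor_fun p q (f : altform V p) (g : altform V q) x y : R :=
  f x * g y.

Fact dtensor_altl p q (f : altform V p) (g : altform V q) y :
  alternating (fun x => dtensor_fun f g x y).
Proof.
apply: (alternating_ext _ (alternating_scale (g y) (altformP f))) => x.
by rewrite mulrC.
Qed.

Fact dtensor_altr p q (f : altform V p) (g : altform V q) x :
  alternating (dtensor_fun f g x).
Proof. exact: alternating_scale (altformP g). Qed.

Definition dtensor p q (f : altform V p) (g : altform V q) : dform p q :=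
  DForm (dtensor_altl f g) (dtensor_altr f g).

(* The wedge product in both groups of arguments at once; dmul_tensor, dmulPl
   and dmulPr below say that this is the bilinear extension of
   (f1 (x) f2) (f3 (x) f4) = (f1 /\ f3) (x) (f2 /\ f4). *)
Definition dmul_fun p q r s (w1 : dform p q) (w2 : dform r s)
    (x : {ffun 'I_(p + r) -> V}) (y : {ffun 'I_(q + s) -> V}) : R :=
  ((p`! * r`!)%:R)^-1 * ((q`! * s`!)%:R)^-1 *
  \sum_(a : 'S_(p + r)) \sum_(b : 'S_(q + s))
     (-1) ^+ a * (-1) ^+ b *
     (w1 (left_args (permf x a)) (left_args (permf y b)) *
      w2 (right_args (permf x a)) (right_args (permf y b))).

Fact dmul_altl p q r s (w1 : dform p q) (w2 : dform r s) y :
  alternating (fun x => dmul_fun w1 w2 x y).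
Proof.
pose F (b : 'S_(q + s)) := wedge_fun
  (fun x => w1 x (left_args (permf y b))) (fun x => w2 x (right_args (permf y b))).
have FA b : alternating (F b) by apply: wedge_alternating; apply: dform_altl.
apply: (alternating_ext _ (alternating_scale ((q`! * s`!)%:R)^-1
  (alternating_sum (index_enum _) xpredT (fun b : 'S_(q + s) => (-1) ^+ b) FA))) => x.
rewrite /dmul_fun mulrAC [RHS]mulrC; congr (_ * _).
rewrite exchange_big mulr_sumr /=; apply: eq_bigr => b _.
rewrite /F /wedge_fun mulrCA; congr (_ * _).
by rewrite mulr_sumr; apply: eq_bigr => a _; rewrite mulrCA !mulrA.
Qed.

Fact dmul_altr p q r s (w1 : dform p q) (w2 : dform r s) x :
  alternating (dmul_fun w1 w2 x).
Proof.
pose F (a : 'S_(p + r)) := wedge_fun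
  (w1 (left_args (permf x a))) (w2 (right_args (permf x a))).
have FA a : alternating (F a) by apply: wedge_alternating; apply: dform_altr.
apply: (alternating_ext _ (alternating_scale ((p`! * r`!)%:R)^-1
  (alternating_sum (index_enum _) xpredT (fun a : 'S_(p + r) => (-1) ^+ a) FA))) => y.
rewrite /dmul_fun -mulrA; congr (_ * _).
rewrite mulr_sumr /=; apply: eq_bigr => a _.
rewrite /F /wedge_fun mulrCA; congr (_ * _).
by rewrite mulr_sumr; apply: eq_bigr => b _; rewrite !mulrA.
Qed.

Definition dmul p q r s (w1 : dform p q) (w2 : dform r s) :
    dform (p + r) (q + s) :=
  DForm (dmul_altl w1 w2) (dmul_altr w1 w2).

Lemma dmul_tensor p q r s (f1 : altform V p) (f2 : altform V q)
    (f3 : altform V r) (f4 : altform V s) :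
  dmul (dtensor f1 f2) (dtensor f3 f4) =2 dtensor (wedge f1 f3) (wedge f2 f4).
Proof.
move=> x y; rewrite /= /dmul_fun /dtensor_fun /= /wedge_fun mulrACA.
congr (_ * _); rewrite big_distrl /=; apply: eq_bigr => a _.
rewrite big_distrr /=; apply: eq_bigr => b _.
by rewrite [in RHS]mulrACA; congr (_ * _); rewrite /= /dtensor_fun mulrACA.
Qed.

Lemma dmulPl p q r s c (w w1 w1' : dform p q) (w2 : dform r s) :
  w =2 (fun x y => c * w1 x y + w1' x y) ->
  dmul w w2 =2 (fun x y => c * dmul w1 w2 x y + dmul w1' w2 x y).
Proof.
move=> wE x y; rewrite /= /dmul_fun mulrCA -mulrDr; congr (_ * _).
rewrite mulr_sumr -big_split /=; apply: eq_bigr => a _.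
rewrite mulr_sumr -big_split /=; apply: eq_bigr => b _.
by rewrite wE [c * (_ * (_ * _))]mulrCA -mulrDr; congr (_ * _); rewrite mulrDl mulrA.
Qed.

Lemma dmulPr p q r s c (w1 : dform p q) (w w2 w2' : dform r s) :
  w =2 (fun x y => c * w2 x y + w2' x y) ->
  dmul w1 w =2 (fun x y => c * dmul w1 w2 x y + dmul w1 w2' x y).
Proof.
move=> wE x y; rewrite /= /dmul_fun mulrCA -mulrDr; congr (_ * _).
rewrite mulr_sumr -big_split /=; apply: eq_bigr => a _.
rewrite mulr_sumr -big_split /=; apply: eq_bigr => b _.
by rewrite wE [c * (_ * (_ * _))]mulrCA -mulrDr; congr (_ * _); rewrite mulrDr mulrCA.
Qed.

Fact done_alt (c : R) : alternating (fun _ : {ffun 'I_0 -> V} => c).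
Proof. by split=> x []. Qed.

Definition dform1 : dform 0 0 := DForm (fun _ => done_alt 1) (fun _ => done_alt 1).

Fixpoint dpow (w : dform 1 1) (k : nat) : dform k k :=
  if k is k'.+1 then dmul w (dpow w k') else dform1.

Fact dscale_altl p q a (w : dform p q) y :
  alternating (fun x => a * w x y).
Proof. exact: alternating_scale (dform_altl w y). Qed.

Fact dscale_altr p q a (w : dform p q) x :
  alternating (fun y => a * w x y).
Proof. exact: alternating_scale (dform_altr w x). Qed.

Definition dscale p q a (w : dform p q) : dform p q :=
  DForm (dscale_altl a w) (dscale_altr a w).

Fact dform_of_bilin_altl (b : {biscalar V}) (y : {ffun 'I_1 -> V}) :
  alternating (fun x : {ffun 'I_1 -> V} => b (x ord0) (y ord0)).
Proof.
by apply: (alternating_linear (f := fun u => b u (y ord0))) => a u v; rewrite linearPl.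
Qed.

Fact dform_of_bilin_altr (b : {biscalar V}) (x : {ffun 'I_1 -> V}) :
  alternating (fun y : {ffun 'I_1 -> V} => b (x ord0) (y ord0)).
Proof. by apply: alternating_linear => a u v; rewrite linearPr. Qed.

Definition dform_of_bilin (b : {biscalar V}) : dform 1 1 :=
  DForm (dform_of_bilin_altl b) (dform_of_bilin_altr b).

End DoubleForms.

Section Euclidean.
Variables (R : realType) (V : vectType R) (g : {dot V for idfun}).
Local Notation n := (\dim {:V}).

(* The contraction computed in the basis e. *)
Definition contraction (e : n.-tuple V) (w : dform V 1 1) : R :=
  \sum_(i < n) w [ffun=> e`_i] [ffun=> e`_i].

(* The volume form of the orientation for which e, an orthonormal basis, is
   positive. *)
Definition vol (e : n.-tuple V) (x : {ffun 'I_n -> V}) : R :=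
  \det (\matrix_(i, j) g (x i) e`_j).

Definition increasing p (I : {ffun 'I_p -> 'I_n}) : bool :=
  [forall i : 'I_p, forall j : 'I_p, (i < j)%N ==> (I i < I j)%N].

Definition basis_args (e : n.-tuple V) p (I : {ffun 'I_p -> 'I_n}) :
    {ffun 'I_p -> V} := [ffun i => e`_(I i)].

(* With m + p = n, the Hodge star Lambda^m V -> Lambda^p V defined by
   u /\ *w = <u, w> vol is
   *(x_1 /\ ... /\ x_m) = sum over I of
       vol (x_1, ..., x_m, e_I1, ..., e_Ip) (e_I1 /\ ... /\ e_Ip),
   for I_1 < ... < I_p; hodge_coord is its coordinate of index I. *)
Definition hodge_coord (e : n.-tuple V) m p (mpn : (m + p)%N = n)
    (x : {ffun 'I_m -> V}) (I : {ffun 'I_p -> 'I_n}) : R :=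
  vol e [ffun i => join_args x (basis_args e I) (cast_ord (esym mpn) i)].

(* omega ( *x, *y ), expanded by bilinearity. *)
Definition dstar_fun (e : n.-tuple V) m p (mpn : (m + p)%N = n)
    (w : dform V p p) (x y : {ffun 'I_m -> V}) : R :=
  \sum_(I : {ffun 'I_p -> 'I_n} | increasing I)
  \sum_(J : {ffun 'I_p -> 'I_n} | increasing J)
     hodge_coord e mpn x I * hodge_coord e mpn y J *
     w (basis_args e I) (basis_args e J).

Lemma vol_alternating e : alternating (vol e).
Proof.
split=> [x i a u v|x i j ij xij].
  rewrite -[vol e (upd x i v)]mul1r.
  apply: (determinant_multilinear (i0 := i)).
  - by apply/rowP=> j; rewrite !mxE !ffunE !eqxx linearPl /= mul1r.
  - apply/matrixP=> k j; rewrite !mxE !ffunE.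
    by rewrite eq_sym (negPf (neq_lift i k)).
  - apply/matrixP=> k j; rewrite !mxE !ffunE.
    by rewrite eq_sym (negPf (neq_lift i k)).
by apply: (determinant_alternate ij) => k; rewrite !mxE xij.
Qed.

Lemma hodge_alternating e m p (mpn : (m + p)%N = n) (I : {ffun 'I_p -> 'I_n}) :
  alternating (fun x => hodge_coord e mpn x I).
Proof.
pose J (x : {ffun 'I_m -> V}) : {ffun 'I_n -> V} :=
  [ffun i => join_args x (basis_args e I) (cast_ord (esym mpn) i)].
have JE x i : J x (cast_ord mpn (lshift p i)) = x i.
  by rewrite !ffunE cast_ordK (unsplitK (inl i)).
have Jupd x i v : J (upd x i v) = upd (J x) (cast_ord mpn (lshift p i)) v.
  apply/ffunP=> k; rewrite -(cast_ordKV mpn k) [RHS]ffunE.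
  rewrite (inj_eq (@cast_ord_inj _ _ mpn)).
  case: (split_ordP (cast_ord (esym mpn) k)) => c ->.
    by rewrite !JE ffunE (inj_eq (@lshift_inj _ _)).
  by rewrite eq_rlshift !ffunE cast_ordK !(unsplitK (inr c)).
have [vl va] := vol_alternating e.
split=> [x i a u v|x i j ij xij]; rewrite /hodge_coord.
  by rewrite -!/(J _) !Jupd vl.
apply: (va _ (cast_ord mpn (lshift p i)) (cast_ord mpn (lshift p j))).
  by rewrite (inj_eq (@cast_ord_inj _ _ mpn)) (inj_eq (@lshift_inj _ _)).
by rewrite -/(J x) !JE.
Qed.

Fact dstar_altl e m p (mpn : (m + p)%N = n) (w : dform V p p) y :
  alternating (fun x => dstar_fun e mpn w x y).
Proof.
apply: (alternating_ext _ (alternating_sum (index_enum _) (@increasing p)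
  (fun I => \sum_(J | increasing J)
      hodge_coord e mpn y J * w (basis_args e I) (basis_args e J))
  (hodge_alternating e mpn))) => x.
apply: eq_bigr => I _; rewrite mulr_suml; apply: eq_bigr => J _.
by rewrite mulrC mulrA.
Qed.

Fact dstar_altr e m p (mpn : (m + p)%N = n) (w : dform V p p) x :
  alternating (dstar_fun e mpn w x).
Proof.
apply: (alternating_ext _ (alternating_sum (index_enum _) (@increasing p)
  (fun J => \sum_(I | increasing I)
      hodge_coord e mpn x I * w (basis_args e I) (basis_args e J))
  (hodge_alternating e mpn))) => y.
rewrite [RHS]exchange_big /=.
apply: eq_bigr => I _; rewrite mulr_suml; apply: eq_bigr => J _.
by rewrite mulrAC.
Qed.

Definition dstar e m p (mpn : (m + p)%N = n) (w : dform V p p) : dform V m m :=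
  DForm (dstar_altl e mpn w) (dstar_altr e mpn w).

(* The operator corresponding to h via g; see bar_opP. *)
Definition flat (b : {biscalar V}) : 'Hom(V, 'Hom(V, R^o)) :=
  linfun (fun u => linfun (b u : V -> R^o)).

Definition bar_op (h : {biscalar V}) : 'End(V) :=
  ((flat g)^-1 \o flat h)%VF.

Lemma flatE (b : {biscalar V}) u v : flat b u v = b u v.
Proof.
have bl w : linear (b w : V -> R^o) by move=> a x y; rewrite linearPr.
pose bw w : {linear V -> R^o} :=
  HB.pack (b w : V -> R^o) (GRing.isLinear.Build _ _ _ _ _ (bl w)).
pose F u := linfun (b u : V -> R^o).
have FE x y : F x y = b x y by rewrite (lfunE (bw x)).
have Fl : linear F.
  by move=> a x y; apply/lfunP=> z; rewrite add_lfunE scale_lfunE !FE linearPl.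
pose Fw : {linear V -> 'Hom(V, R^o)} :=
  HB.pack F (GRing.isLinear.Build _ _ _ _ _ Fl).
by rewrite (lfunE Fw) FE.
Qed.

Lemma bar_opP (h : {biscalar V}) u v : g (bar_op h u) v = h u v.
Proof.
have kg : lker (flat g) == 0%VS.
  apply/eqP/vspaceP=> x; rewrite memv_ker memv0; apply/eqP/eqP=> [x0|->].
    apply/eqP; apply: contraT => xN0.
    by have : 0 < g x x := neq0_dnorm_gt0 _ xN0; rewrite -(flatE g) x0 lfunE ltxx.
  by rewrite linear0.
rewrite -[LHS](flatE g) /bar_op comp_lfunE limg_lfunVK ?flatE //.
suff -> : limg (flat g) = fullv by rewrite memvf.
apply/eqP; rewrite eqEdim subvf limg_dim_eq ?(eqP kg) ?capv0 //.
by rewrite !dimvf -[X in (_ <= X)%N]muln1; apply: leqnn.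
Qed.

(* Computed in the basis vbasis {:V} of V; the determinant is the same in
   every basis. *)
Definition op_mx (f : 'End(V)) : 'M[R]_n := passmx.mxof (vbasis {:V}) (vbasis {:V}) f.

Definition op_det (f : 'End(V)) : R := \det (op_mx f).

(* det (f - lambda I) as a polynomial in lambda. *)
Definition op_char (f : 'End(V)) : {poly R} :=
  \det (map_mx polyC (op_mx f) - 'X%:M).

Definition char_coef (h : {biscalar V}) (k : nat) : R :=
  (-1) ^+ (n - k) * (op_char (bar_op h))`_(n - k).

Lemma op_charE f lam : (op_char f).[lam] = op_det (f - lam *: \1%VF).
Proof.
rewrite /op_char /op_det -horner_evalE -det_map_mx; congr (\det _).
rewrite /op_mx [f - _]addrC -scaleNr passmx.mxof_linear.
rewrite passmx.mxof1 ?(basis_free (vbasisP _)) //.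
apply/matrixP=> i j; rewrite !mxE /= horner_evalE hornerD hornerN hornerMn.
rewrite hornerC hornerX addrC.
by rewrite mulr_natr mulNrn.
Qed.

Lemma size_op_char f : (size (op_char f) <= n.+1)%N.
Proof.
have -> : op_char f = ((-1) ^+ n)%:P * char_poly (op_mx f).
  rewrite /op_char /char_poly /char_poly_mx.
  set A := map_mx _ _; have -> : A - 'X%:M = (-1) *: ('X%:M - A).
    by rewrite scaleN1r opprB.
  by rewrite detZ polyC_exp polyCN.
by rewrite mul_polyC (leq_trans (size_scale_leq _ _)) // size_char_poly.
Qed.

Lemma char_coefP (h : {biscalar V}) lam :
  op_det (bar_op h - lam *: \1%VF) =
  \sum_(0 <= k < n.+1) (-1) ^+ (n - k) * char_coef h k * lam ^+ (n - k).
Proof.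
rewrite -op_charE (horner_coef_wide lam (size_op_char (bar_op h))).
rewrite -(big_mkord xpredT (fun i => (op_char (bar_op h))`_i * lam ^+ i)).
rewrite big_nat_rev /=; apply: eq_big_nat => i /andP[_ i_le].
have -> : (0 + n.+1 - i.+1 = n - i)%N by rewrite add0n subSS.
by congr (_ * _); rewrite /char_coef signrMK.
Qed.

Fact t_form_degree k : (k < n)%N -> (1 + ((n.-1 - k) + k))%N = n.
Proof. by move=> kn; case: (n) kn => // m; rewrite ltnS => km; rewrite subnK. Qed.

Definition t_form (e : n.-tuple V) (h : {biscalar V}) k (kn : (k < n)%N) :
    dform V 1 1 :=
  dscale ((k`! * (n.-1 - k)`!)%:R)^-1
    (dstar e (t_form_degree kn)
       (dmul (dpow (dform_of_bilin g) (n.-1 - k)) (dpow (dform_of_bilin h) k))).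

End Euclidean.

(* Main.v *)
From HB Require Import structures.
Require Import Defs.
From mathcomp Require Import all_boot all_order all_fingroup all_algebra.
From mathcomp Require Import reals zify.

(* Work in the orthonormal basis e, with H = (h (e_i, e_j)).  In the contraction
   of *w, the only increasing multi-index avoiding i is j |-> lift i j, so that
   c ( *w) = sum_i w (e_(lift i), e_(lift i)).  The Laplace expansion turns the
   value of g^a h^k (a = n - 1 - k) there into a sum over permutations of the determinants whose
   rows come from H (k of them) or from the identity matrix, that is, into
   a! k! times the sum of the principal k-minors of H that avoid i.  Each principal
   k-minor avoids n - k indices i, and the sum of the principal k-minors is s_k. *)

Set Implicit Arguments.
Unset Strict Implicit.
Unset Printing Implicit Defensive.

Import Order.TTheory GRing.Theory Num.Theory.
Local Open Scope ring_scope.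

(** * Counting permutations by the preimage of a fixed subset *)

Section PermutationsAndSubsets.

Variable T : finType.

(** Listing a set and then its complement enumerates [T]; matching the list of [B] with that of [A]
    position by position gives [s]. *)
Lemma perm_of_card_eq (A B : {set T}) : #|A| = #|B| -> exists s : {perm T}, s @^-1: A = B.
Proof.
move=> AB; have en (C : {set T}) : perm_eq (enum C ++ enum (~: C)) (enum T).
  apply: uniq_perm; rewrite ?enum_uniq ?cat_uniq ?enum_uniq ?andbT //.
    by apply/hasPn=> x; rewrite !mem_enum inE.
  by move=> x; rewrite mem_cat !mem_enum !inE orbN.
have szE (C : {set T}) : size (enum C ++ enum (~: C)) = #|T|.
  by rewrite (perm_size (en C)) -cardE.
pose sq (C : {set T}) (x : T) := index x (enum C ++ enum (~: C)).
have sqlt (C : {set T}) x : (sq C x < #|T|)%N.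
  by rewrite -(szE C) index_mem (perm_mem (en C)) mem_enum.
pose f x := nth x (enum A ++ enum (~: A)) (sq B x).
have f_inj : injective f.
  move=> x y; rewrite /f (set_nth_default x y) ?szE //.
  move/eqP; rewrite nth_uniq ?szE ?(perm_uniq (en A)) ?enum_uniq // => /eqP.
  by apply: index_inj; rewrite ?(perm_mem (en B)) ?mem_enum.
exists (perm f_inj); apply/setP=> x; rewrite inE permE /f nth_cat -cardE AB.
have -> : (sq B x < #|B|)%N = (x \in B).
  rewrite /sq index_cat mem_enum; case: ifP => xB; last by rewrite -cardE ltnNge leq_addr.
  by rewrite cardE index_mem mem_enum.
case: ifP => xB.
  by rewrite -mem_enum mem_nth // -cardE AB cardE /sq index_cat mem_enum xB index_mem mem_enum.
apply/negbTE; rewrite -in_setC -mem_enum mem_nth //.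
rewrite -(ltn_add2l #|B|) subnKC; last first.
  by rewrite /sq index_cat mem_enum xB -cardE leq_addr.
by rewrite -{1}AB [X in (X + _)%N]cardE -size_cat szE.
Qed.

(** The sets of size [#|A|] are the preimages of equally many permutations, since left
    multiplication by a permutation carries one fibre to another. *)
Lemma sum_perm_preimset (M : nmodType) (A : {set T}) (F : {set T} -> M) :
  \sum_(s : {perm T}) F (s @^-1: A) =
  (\sum_(S : {set T} | #|S| == #|A|) F S) *+ (#|A|`! * (#|T| - #|A|)`!).
Proof.
pose c (C : {set T}) := #|[pred s : {perm T} | s @^-1: A == C]|.
have card_preim (s : {perm T}) : #|s @^-1: A| = #|A|.
  by rewrite on_card_preimset //; exists s^-1%g => x _; rewrite ?permK ?permKV.
have cA (C : {set T}) : #|C| == #|A| -> c C = c A.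
  move=> /eqP/esym/perm_of_card_eq[t tAC].
  rewrite /c -!sum1_card (reindex_inj (mulgI t)) /=; apply: eq_bigl => s.
  rewrite !inE -tAC; apply/eqP/eqP => [/setP e|/setP e]; apply/setP=> x.
    by have := e (t^-1%g x); rewrite !inE permM permKV.
  by have := e (t x); rewrite !inE permM.
have sum_c (N : nmodType) (G : {set T} -> N) :
    \sum_(s : {perm T}) G (s @^-1: A) =
    (\sum_(S : {set T} | #|S| == #|A|) G S) *+ c A.
  rewrite (partition_big (fun s : {perm T} => s @^-1: A) (fun S => #|S| == #|A|)) /=.
    rewrite -sumrMnl; apply: eq_bigr => S /cA <-.
    by rewrite /c -sumr_const; apply: eq_bigr => s /eqP ->.
  by move=> s _; apply/eqP.
rewrite sum_c; congr (_ *+ _).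
(* For the constant 1 the identity reads [#|T|]! = binomial times [c A], which determines the fibre
   size. *)
have := sum_c int (fun _ => 1); rewrite !sumr_const -mulrnA => /eqP.
rewrite eqr_nat => /eqP.
have -> : #|{: {perm T}}| = (#|T|)`!.
  rewrite -[#|T|]cardsT -card_perm; apply: eq_card => s; rewrite !inE.
  by apply/esym/subsetP=> x _; rewrite inE.
have -> : #|[pred S : {set T} | #|S| == #|A|]| = 'C(#|T|, #|A|).
  by rewrite -card_draws; apply: eq_card => S; rewrite !inE.
rewrite -(bin_fact (max_card (mem A))) => /eqP.
by rewrite eqn_pmul2l ?bin_gt0 ?max_card // => /eqP.
Qed.

End PermutationsAndSubsets.

(** * Principal minors and the characteristic polynomial *)

Section MixedMinors.

Variable R : comNzRingType.

(* Its determinant is the principal minor of A on S. *)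
Definition mixed_mx n (S : {set 'I_n}) (A : 'M[R]_n) : 'M[R]_n :=
  \matrix_(i, j) if i \in S then A i j else (i == j)%:R.

(** Row [i] of the mixed matrix is a unit row, because [lift i] avoids [i]; expand along it. *)
Lemma det_mixed_lift n (i : 'I_n.+1) (S : {set 'I_n}) (A : 'M[R]_n.+1) :
  \det (mixed_mx (lift i @: S) A) = \det (mixed_mx S (row' i (col' i A))).
Proof.
have iS : i \notin lift i @: S by apply/imsetP=> -[j _ /eqP]; rewrite (negPf (neq_lift i j)).
rewrite (expand_det_row _ i) (bigD1 i) //= big1 ?addr0 => [|j ji]; last first.
  by rewrite mxE (negPf iS) eq_sym (negPf ji) mul0r.
rewrite mxE (negPf iS) eqxx mul1r /cofactor addnn -signr_odd odd_double mul1r.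
congr (\det _); apply/matrixP=> r c; rewrite !mxE (mem_imset _ _ (@lift_inj _ i)).
by rewrite (inj_eq (@lift_inj _ i)).
Qed.

(** In each Leibniz term, distributing the product selects the set [S] of rows that contribute an
    entry of [A]; every other row contributes [- 'X] times an entry of the identity. *)
Lemma coef_det_subX n (A : 'M[R]_n) k : (k <= n)%N ->
  (\det (map_mx polyC A - 'X%:M))`_(n - k) =
  (-1) ^+ (n - k) * \sum_(S : {set 'I_n} | #|S| == k) \det (mixed_mx S A).
Proof.
move=> kn.
have -> : \det (map_mx polyC A - 'X%:M) =
    \sum_(S : {set 'I_n}) ((-1) ^+ (n - #|S|) * \det (mixed_mx S A))%:P * 'X^(n - #|S|).
  under [RHS]eq_bigr => S _ do rewrite /determinant mulr_sumr rmorph_sum mulr_suml.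
  rewrite exchange_big; apply: eq_bigr => s _ /=.
  under eq_bigr => i _ do rewrite !mxE.
  rewrite bigA_distr mulr_sumr; apply: eq_bigr => S _.
  rewrite mulrCA !rmorphM !rmorph_sign -!mulrA; congr (_ * _).
  have -> : \prod_(i < n) (if i \in S then (A i (s i))%:P else - ('X *+ (i == s i))) =
      (\prod_i mixed_mx S A i (s i))%:P * \prod_i (if i \in S then 1 else - 'X) :> {poly R}.
    rewrite rmorph_prod -big_split; apply: eq_bigr => i _ /=; rewrite mxE.
    by case: ifP => _; rewrite ?mulr1 //=; case: eqP; rewrite ?mulr1n ?mulr0n ?mul1r ?mul0r ?oppr0.
  rewrite mulrCA; congr (_ * _).
  rewrite (eq_bigr (fun i => if i \in ~: S then - 'X else 1)); last first.
    by move=> i _; rewrite inE; case: ifP.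
  by rewrite -big_mkcond prodr_const [in LHS]cardsCs setCK card_ord [LHS]exprNn.
rewrite coef_sum mulr_sumr [RHS]big_mkcond; apply: eq_bigr => S _.
(* Truncated subtraction from [n] can be cancelled because [k] and [#|S|] are both at most [n]. *)
rewrite coefCM coefXn eqn_sub2lE //; last by rewrite -[n in (_ <= n)%N]card_ord max_card.
by rewrite eq_sym; case: eqP => [->|_]; rewrite ?mulr1 ?mulr0.
Qed.

End MixedMinors.

(** The sets [lift i @: S] are exactly the [k]-subsets avoiding [i]; after exchanging the sums, each
    [T] is counted once per element of its complement. *)
Lemma sum_sets_lift (M : nmodType) (n k : nat) (F : {set 'I_n.+1} -> M) :
  \sum_(i < n.+1) \sum_(S : {set 'I_n} | #|S| == k) F (lift i @: S) =
  (\sum_(T : {set 'I_n.+1} | #|T| == k) F T) *+ (n.+1 - k).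
Proof.
have avoid (i : 'I_n.+1) : \sum_(S : {set 'I_n} | #|S| == k) F (lift i @: S) =
    \sum_(T : {set 'I_n.+1} | (#|T| == k) && (i \notin T)) F T.
  rewrite [RHS](reindex_onto (fun S : {set 'I_n} => lift i @: S)
                             (fun T => lift i @^-1: T)) /=; last first.
    move=> T /andP[_ iT]; apply/setP=> j; apply/imsetP/idP => [[c + ->]|jT].
      by rewrite inE.
    case: (unliftP i j) jT => [c ->|->] jT; first by exists c; rewrite ?inE.
    by rewrite jT in iT.
  apply: eq_bigl => S; rewrite (card_imset _ (@lift_inj _ i)).
  have -> : i \notin lift i @: S.
    by apply/imsetP=> -[j _ /eqP]; rewrite (negPf (neq_lift i j)).
  have -> : lift i @^-1: (lift i @: S) == S.
    by apply/eqP/setP=> j; rewrite inE (mem_imset _ _ (@lift_inj _ i)).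
  by rewrite !andbT.
rewrite (eq_bigr _ (fun i _ => avoid i))
  (exchange_big_dep (fun T : {set 'I_n.+1} => #|T| == k)) /=; last first.
  by move=> i T _ /andP[].
rewrite -sumrMnl; apply: eq_bigr => T Tk.
rewrite (eq_bigl (fun i => i \in ~: T)) => [|i]; last by rewrite Tk inE.
by rewrite sumr_const cardsCs setCK card_ord (eqP Tk).
Qed.

(** The values of [I] and those of [lift i] form strictly increasing lists of equal length, the
    first contained in the second. *)
Lemma incr_avoiding m (i : 'I_m.+1) (I : {ffun 'I_m -> 'I_m.+1}) :
  [forall a : 'I_m, forall b : 'I_m, (a < b)%N ==> (I a < I b)%N] ->
  (forall a, I a != i) -> I = [ffun a => lift i a].
Proof.
move=> incI avI.
pose s1 := [seq val (I a) | a <- enum 'I_m]; pose s2 := [seq val (lift i a) | a <- enum 'I_m].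
have mono (f : 'I_m -> nat) : {homo f : a b / (a < b)%N} -> sorted ltn (map f (enum 'I_m)).
  move=> fm; rewrite sorted_map; apply: (sub_sorted fm).
  by have := iota_ltn_sorted 0 m; rewrite -val_enum_ord sorted_map.
have s1s : sorted ltn s1.
  by apply: (mono (fun a => val (I a))) => a b ab; apply: (implyP (forallP (forallP incI a) b)).
have s2s : sorted ltn s2.
  apply: (mono (fun a => val (lift i a))) => a b ab; rewrite /= /bump.
  by lia.
have s12 : {subset s1 <= s2}.
  move=> _ /mapP[a _ ->]; case: (unliftP i (I a)) (avI a) => [c -> _|->]; last by rewrite eqxx.
  by apply/mapP; exists c; rewrite ?mem_enum.
have e12 : s1 = s2.
  apply: (irr_sorted_eq ltn_trans ltnn) => //; apply: (uniq_min_size _ s12 _).2.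
    exact: (sorted_uniq ltn_trans ltnn).
  by rewrite !size_map.
apply/ffunP=> a; rewrite ffunE; apply: val_inj.
by apply: (eq_in_map _ _ _).2 e12 _ _; rewrite ?mem_enum.
Qed.

(** * The Hodge star and the mixed minors in coordinates *)

Section StarMinors.

Variable R : comNzRingType.

(* Its determinant is vol (e_i, e_I) for an orthonormal basis e. *)
Definition star_mx n m (mn : (1 + m)%N = n) (i : 'I_n) (I : {ffun 'I_m -> 'I_n}) : 'M[R]_n :=
  \matrix_(r, c)
    ((if split (cast_ord (esym mn) r) is inr b then I b else i) == c)%:R.

(** An increasing multi-index other than [L] takes the value [i], so its star matrix has two equal
    rows; only the term [I = J = L] survives. *)
Lemma sum_star_mx m (mn : (1 + m)%N = m.+1) (i : 'I_m.+1)
    (W : {ffun 'I_m -> 'I_m.+1} -> {ffun 'I_m -> 'I_m.+1} -> R) :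
  let incr (I : {ffun 'I_m -> 'I_m.+1}) :=
    [forall a : 'I_m, forall b : 'I_m, (a < b)%N ==> (I a < I b)%N] in
  \sum_(I | incr I) \sum_(J | incr J)
    \det (star_mx mn i I) * \det (star_mx mn i J) * W I J =
  W [ffun a => lift i a] [ffun a => lift i a].
Proof.
move=> incr; set L := [ffun a => lift i a].
have star0 I : incr I -> I != L -> \det (star_mx mn i I) = 0.
  move=> incI IL; have /existsP[b /eqP Ib] : [exists b, I b == i].
    apply: contraR IL; rewrite negb_exists => /forallP Ii.
    by apply/eqP/incr_avoiding.
  apply: (determinant_alternate (i1 := cast_ord mn (lshift m ord0))
    (i2 := cast_ord mn (rshift 1 b))).
    by rewrite (inj_eq (@cast_ord_inj _ _ mn)) eq_lrshift.
  by move=> c; rewrite !mxE !cast_ordK (unsplitK (inl ord0)) (unsplitK (inr b)) /= Ib.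
have incL : incr L.
  apply/forallP=> a; apply/forallP=> b; apply/implyP=> ab.
  by rewrite !ffunE /= /bump; lia.
(* The rows are distinct unit vectors, so the matrix is orthogonal; the square of its determinant is
   1 whatever its sign. *)
have starL : \det (star_mx mn i L) * \det (star_mx mn i L) = 1.
  rewrite -{2}det_tr -det_mulmx; apply: etrans (det1 _ _); congr (\det _).
  apply/matrixP=> r s; rewrite !mxE.
  set K := fun r : 'I_m.+1 =>
    if split (cast_ord (esym mn) r) is inr b then L b else i.
  have K_inj : injective K.
    move=> x y; rewrite /K => xy; apply: (@cast_ord_inj _ _ (esym mn)); move: xy.
    case: (split_ordP (cast_ord (esym mn) x)) => u ->;
      case: (split_ordP (cast_ord (esym mn) y)) => v ->.
    - by rewrite (ord1 u) (ord1 v).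
    - by rewrite ffunE => /eqP; rewrite (negPf (neq_lift i v)).
    - by rewrite ffunE => /eqP; rewrite eq_sym (negPf (neq_lift i u)).
    - by rewrite !ffunE => /lift_inj ->.
  rewrite (bigD1 (K r)) //= big1 ?addr0 => [|c cK]; last first.
    by rewrite mxE -/(K r) eq_sym (negPf cK) mul0r.
  by rewrite !mxE -/(K r) -/(K s) eqxx mul1r (inj_eq K_inj) eq_sym.
rewrite (bigD1 L) //= [X in _ + X]big1 ?addr0 => [|I /andP[incI IL]]; last first.
  by rewrite big1 // => J _; rewrite star0 // !mul0r.
rewrite (bigD1 L) //= [X in _ + X]big1 ?addr0 => [|I /andP[incI IL]].
  by rewrite starL mul1r.
by rewrite (star0 I) // mulr0 mul0r.
Qed.

(* The value of g^a h^k on (e_I, e_J), for an orthonormal basis e and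
   H = (h (e_i, e_j)); see dmul_gram. *)
Definition mixed_sum a k n (H : 'M[R]_n) (I J : {ffun 'I_(a + k) -> 'I_n}) : R :=
  \sum_(s : 'S_(a + k)) (-1) ^+ s *
    \det (\matrix_(r, c) if (r < a)%N then (I (s r) == J c)%:R
                          else H (I (s r)) (J c)).

(** Undoing the row permutation absorbs the sign and moves the permutation onto the choice of rows:
    the rows taken from [H] become the preimage of the last [k] positions [A], to which
    [sum_perm_preimset] applies. *)
Lemma mixed_sum_lift a k (H : 'M[R]_((a + k).+1)) (i : 'I_(a + k).+1) :
  mixed_sum H [ffun r => lift i r] [ffun r => lift i r] =
  (\sum_(S : {set 'I_(a + k)} | #|S| == k) \det (mixed_mx (lift i @: S) H))
     *+ (a`! * k`!).
Proof.
pose A := [set r : 'I_(a + k) | (a <= r)%N].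
have cardA : #|A| = k.
  have -> : A = (@rshift a k) @: setT.
    apply/setP=> r; rewrite inE; apply/idP/imsetP => [|[j _ ->]]; last exact: leq_addr.
    by by case: (split_ordP r) => j -> /=; [rewrite leqNgt ltn_ord|exists j].
  by rewrite card_imset ?cardsT ?card_ord //; apply: rshift_inj.
under [in RHS]eq_bigr => S _ do rewrite det_mixed_lift.
have -> : (a`! * k`! = #|A|`! * (#|'I_(a + k)| - #|A|)`!)%N.
  by rewrite card_ord cardA addnK mulnC.
rewrite (eq_bigl (fun S : {set 'I_(a + k)} => #|S| == #|A|)) => [|S]; last by rewrite cardA.
rewrite -sum_perm_preimset /mixed_sum [LHS](reindex_inj invg_inj) /=.
apply: eq_bigr => s _; rewrite odd_permV.
set M := mixed_mx _ _; have -> : \det M = (-1) ^+ s * \det (row_perm s^-1 M).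
  by rewrite row_permE det_mulmx det_perm odd_permV signrMK.
congr (_ * \det _); apply/matrixP=> r c; rewrite !mxE !inE !ffunE permKV.
by rewrite leqNgt if_neg (inj_eq (@lift_inj _ i)).
Qed.

Lemma trace_star_mx a k n (mn : (1 + (a + k))%N = n) (H : 'M[R]_n) :
  let incr (I : {ffun 'I_(a + k) -> 'I_n}) :=
    [forall i : 'I_(a + k), forall j : 'I_(a + k), (i < j)%N ==> (I i < I j)%N] in
  \sum_(i < n) \sum_(I | incr I) \sum_(J | incr J)
    \det (star_mx mn i I) * \det (star_mx mn i J) * mixed_sum H I J =
  (\sum_(S : {set 'I_n} | #|S| == k) \det (mixed_mx S H))
     *+ ((n - k) * (a`! * k`!)).
Proof.
(* Eliminating the equation makes [n] a successor, as the lemmas on [lift] require. *)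
case: _ / mn H => H incr.
under eq_bigr => i _ do rewrite sum_star_mx mixed_sum_lift.
rewrite sumrMnl [in RHS]mulrnA; congr (_ *+ _).
exact: (sum_sets_lift k (fun T => \det (mixed_mx T H))).
Qed.

End StarMinors.

(** * Laplace expansion as a sum over column permutations *)

Section LaplaceSum.

Variables (R : comNzRingType) (a k : nat).

Definition join_perm_fun (s : 'S_a) (t : 'S_k) (r : 'I_(a + k)) : 'I_(a + k) :=
  match split r with inl i => lshift k (s i) | inr j => rshift a (t j) end.

Fact join_perm_inj s t : injective (join_perm_fun s t).
Proof.
move=> x y; rewrite /join_perm_fun.
case: (split_ordP x) => u ->; case: (split_ordP y) => v -> /eqP.
- by rewrite (inj_eq (@lshift_inj _ _)) => /eqP/perm_inj ->.
- by rewrite eq_lrshift.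
- by rewrite eq_rlshift.
- by rewrite (inj_eq (@rshift_inj _ _)) => /eqP/perm_inj ->.
Qed.

Definition join_perm s t : 'S_(a + k) := perm (@join_perm_inj s t).

Lemma join_permEl s t i : join_perm s t (lshift k i) = lshift k (s i).
Proof. by rewrite permE /join_perm_fun (unsplitK (inl i)). Qed.

Lemma join_permEr s t j : join_perm s t (rshift a j) = rshift a (t j).
Proof. by rewrite permE /join_perm_fun (unsplitK (inr j)). Qed.

(** The permutation matrix of [join_perm s t] is block diagonal. *)
Lemma sign_join_perm s t :
  (-1) ^+ join_perm s t = (-1) ^+ s * (-1) ^+ t :> R.
Proof.
rewrite -!det_perm -(det_ublock _ 0); congr (\det _).
rewrite -[LHS]submxK; congr block_mx; apply/matrixP=> i j; rewrite !mxE.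
- by rewrite join_permEl (inj_eq (@lshift_inj _ _)).
- by rewrite join_permEl eq_lrshift.
- by rewrite join_permEr eq_rlshift.
- by rewrite join_permEr (inj_eq (@rshift_inj _ _)).
Qed.

(** Expanding both blocks over [s1] and [s2] yields the Leibniz term of [M] at
    [join_perm s1 s2 * t]. For each of the [a]! [k]! pairs, translation permutes the [t], so the sum
    over [t] is [\det M]. *)
Lemma sum_perm_det_blocks (M : 'M[R]_(a + k)) :
  \sum_(t : 'S_(a + k)) (-1) ^+ t *
    (\det (ulsubmx (col_perm t M)) * \det (drsubmx (col_perm t M))) =
  \det M *+ (a`! * k`!).
Proof.
have blocksE (t : 'S_(a + k)) : (-1) ^+ t *
    (\det (ulsubmx (col_perm t M)) * \det (drsubmx (col_perm t M))) =
    \sum_(s1 : 'S_a) \sum_(s2 : 'S_k)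
      (-1) ^+ (join_perm s1 s2 * t)%g * \prod_r M r ((join_perm s1 s2 * t)%g r).
  rewrite /determinant big_distrl mulr_sumr; apply: eq_bigr => s1 _.
  rewrite big_distrr mulr_sumr; apply: eq_bigr => s2 _ /=.
  have -> : \prod_i ulsubmx (col_perm t M) i (s1 i) =
      \prod_i M (lshift k i) ((join_perm s1 s2 * t)%g (lshift k i)).
    by apply: eq_bigr => i _; rewrite !mxE permM join_permEl.
  have -> : \prod_j drsubmx (col_perm t M) j (s2 j) =
      \prod_j M (rshift a j) ((join_perm s1 s2 * t)%g (rshift a j)).
    by apply: eq_bigr => j _; rewrite !mxE permM join_permEr.
  rewrite odd_permM signr_addb sign_join_perm big_split_ord /=.
  by rewrite [in LHS]mulrACA [LHS]mulrCA -[RHS]mulrA.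
rewrite (eq_bigr _ (fun t _ => blocksE t)) exchange_big /=.
rewrite (eq_bigr (fun _ => \det M *+ k`!)) => [|s1 _].
  by rewrite sumr_const card_Sn -mulrnA mulnC.
rewrite exchange_big /= (eq_bigr (fun _ => \det M)) ?sumr_const ?card_Sn // => s2 _.
by rewrite [RHS](reindex_inj (mulgI (join_perm s1 s2))).
Qed.

End LaplaceSum.

(** * Products and powers of double forms as determinants *)

Section DoubleFormProducts.

Variables (R : realType) (V : vectType R).

Definition gram (b : V -> V -> R) p (x y : {ffun 'I_p -> V}) : 'M[R]_p :=
  \matrix_(i, j) b (x i) (y j).

(** For a fixed permutation [s] of the first arguments, the sum over permutations of the second ones
    is a Laplace sum for a single matrix. *)
Lemma dmul_gram a k (b1 b2 : V -> V -> R) (w1 : dform V a a) (w2 : dform V k k) :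
  (forall x y, w1 x y = a`!%:R * \det (gram b1 x y)) ->
  (forall x y, w2 x y = k`!%:R * \det (gram b2 x y)) ->
  forall x y, dmul w1 w2 x y =
    \sum_(s : 'S_(a + k)) (-1) ^+ s *
      \det (\matrix_(r, c) (if (r < a)%N then b1 else b2) (x (s r)) (y c)).
Proof.
move=> w1E w2E x y; rewrite /= /dmul_fun.
pose w : R := (a`! * k`!)%:R.
have w_neq0 : w != 0 by rewrite pnatr_eq0 -lt0n muln_gt0 !fact_gt0.
rewrite -/w -mulrA mulr_sumr mulr_sumr; apply: eq_bigr => s _.
set M := \matrix_(r, c) _.
(* The two normalisations [w^-1] cancel against the factorials carried by [w1] and [w2] and against
   the multiplicity of the Laplace sum. *)
transitivity (w^-1 * (w^-1 * ((-1) ^+ s * (w * \sum_(t : 'S_(a + k)) (-1) ^+ t *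
    (\det (ulsubmx (col_perm t M)) * \det (drsubmx (col_perm t M))))))).
  congr (_ * (_ * _)); rewrite 2!mulr_sumr; apply: eq_bigr => t _.
  rewrite -mulrA; congr (_ * _); rewrite [RHS]mulrCA; congr (_ * _).
  rewrite w1E w2E mulrACA -natrM -/w.
  congr (w * (_ * _)); congr (\det _).
    by apply/matrixP=> i j; rewrite !mxE !ffunE /= ltn_ord.
  by apply/matrixP=> i j; rewrite !mxE !ffunE /= ltnNge leq_addr.
rewrite sum_perm_det_blocks -[_ *+ _]mulr_natl -/w.
by do 2 rewrite (mulrCA ((-1) ^+ s)) mulKf //.
Qed.

(** By induction: when both factors come from [b], each summand of [dmul_gram] is the Gram
    determinant with its rows permuted, and the sign restores it. *)
Lemma dpow_bilin (b : {biscalar V}) k x y :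
  dpow (dform_of_bilin b) k x y = k`!%:R * \det (gram b x y).
Proof.
elim: k => [|k IHk] in x y *; first by rewrite det_mx00 mulr1.
have b1E (u v : {ffun 'I_1 -> V}) : dform_of_bilin b u v = 1`!%:R * \det (gram b u v).
  by rewrite det_mx11 mxE mul1r.
rewrite [LHS](dmul_gram b1E IHk).
rewrite (eq_bigr (fun _ => \det (gram b x y))) => [|s _].
  by rewrite sumr_const card_Sn mulr_natl.
transitivity ((-1) ^+ s * \det (row_perm s (gram b x y))).
  by congr (_ * \det _); apply/matrixP=> i j; rewrite !mxE if_same.
by rewrite row_permE det_mulmx det_perm signrMK.
Qed.

End DoubleFormProducts.

(** * Orthonormal bases, contraction and characteristic coefficients *)

Section Orthonormal.

Variables (R : realType) (V : vectType R) (g : {dot V for idfun}).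
Local Notation n := (\dim {:V}).

Lemma dotC u v : g u v = g v u.
Proof. by rewrite [LHS]hermC expr0 mul1r. Qed.

Section Basis.

Variable e : n.-tuple V.
Hypothesis he : orthonormal g e.

Lemma orthonormal_nth (i j : 'I_n) : g e`_i e`_j = (i == j)%:R.
Proof.
have [/allP e1 eo] := andP he.
(* Orthonormality only records products of an entry with later ones; the opposite order follows by
   symmetry. *)
have ltE (p q : 'I_n) : (p < q)%N -> g e`_p e`_q = 0.
  have : (q < size e)%N by rewrite size_tuple.
  elim: (tval e) eo (p : nat) (q : nat) => //= v s IHs /andP[+ so] [|p'] [|q'] //=.
    by rewrite /ortho_rec /= andbT => /allP vs qs _; apply/eqP/vs/mem_nth.
  by move=> _; apply: IHs.
have [ij|ij|/val_inj ->] := ltngtP i j.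
- by rewrite ltE // (_ : i == j = false) //; apply/eqP=> eij; rewrite eij ltnn in ij.
- rewrite dotC ltE // (_ : i == j = false) //.
  by apply/eqP=> eij; rewrite eij ltnn in ij.
- by rewrite eqxx; apply/eqP/e1/mem_nth; rewrite size_tuple.
Qed.

Lemma orthonormal_sum (c : 'I_n -> R) (i : 'I_n) : g (\sum_j c j *: e`_j) e`_i = c i.
Proof.
rewrite linear_sumlz (bigD1 i) //= big1 => [|j ji].
  by rewrite linearZl_LR /= orthonormal_nth eqxx mulr1 addr0.
by rewrite linearZl_LR /= orthonormal_nth (negPf ji) mulr0.
Qed.

Lemma orthonormal_basis : basis_of {:V} e.
Proof.
rewrite basisEfree subvf size_tuple leqnn !andbT; apply/freeP => c c0 i.
by rewrite -(orthonormal_sum c i) c0 linear0l.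
Qed.

Lemma coord_orthonormal v (i : 'I_n) : coord e i v = g v e`_i.
Proof.
by rewrite [in RHS](coord_basis orthonormal_basis (memvf v)) orthonormal_sum.
Qed.

Lemma orthonormal_expand v : v = \sum_(i < n) g v e`_i *: e`_i.
Proof.
rewrite {1}(coord_basis orthonormal_basis (memvf v)).
by apply: eq_bigr => i _; rewrite coord_orthonormal.
Qed.

End Basis.

Lemma contraction_orthonormal (e f : n.-tuple V) (w : dform V 1 1) :
  orthonormal g e -> orthonormal g f -> contraction f w = contraction e w.
Proof.
move=> he hf; rewrite /contraction.
pose b u v := w [ffun=> u] [ffun=> v].
pose Q : 'M[R]_n := \matrix_(i, j) g f`_i e`_j.
(* The base point 0 is immaterial: [upd] overwrites its only argument. *)
have bl v : scalar (b^~ v).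
  move=> a u u'; have := (dform_altl w [ffun=> v]).1 [ffun=> 0] ord0 a u u'.
  by rewrite /b; congr (w _ _ = _ * w _ _ + w _ _); apply/ffunP=> i; rewrite !ffunE (ord1 i).
have br u : scalar (b u).
  move=> a v v'; have := (dform_altr w [ffun=> u]).1 [ffun=> 0] ord0 a v v'.
  by rewrite /b; congr (w _ _ = _ * w _ _ + w _ _); apply/ffunP=> i; rewrite !ffunE (ord1 i).
have sumE (F : V -> R) (c : 'I_n -> R) : scalar F ->
    F (\sum_(i < n) c i *: e`_i) = \sum_(i < n) c i * F e`_i.
  move=> Fl; pose Fw : {linear V -> R^o} := HB.pack F (GRing.isLinear.Build _ _ _ _ _ Fl).
  by apply: etrans (linear_sum Fw _ _ _) _; apply: eq_bigr => i _; apply: (linearZ_LR Fw).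
(* Expanding [f] in [e] shows that the rows of [Q] are orthonormal; the sum over [i] below needs
   this for the columns. *)
have QtQ : Q^T *m Q = 1%:M.
  apply: mulmx1C; apply/matrixP=> i j; rewrite !mxE -(orthonormal_nth hf).
  rewrite [in RHS](orthonormal_expand he f`_i) linear_sumlz; apply: eq_bigr => l _.
  by rewrite !mxE linearZl_LR /= [g e`_l _]dotC.
transitivity (\sum_(j < n) \sum_(l < n) \sum_(i < n) Q i j * Q i l * b e`_j e`_l).
  transitivity (\sum_(i < n) \sum_(j < n) \sum_(l < n) Q i j * Q i l * b e`_j e`_l).
    apply: eq_bigr => i _; rewrite -/(b f`_i f`_i) {1}(orthonormal_expand he f`_i).
    rewrite (sumE (b^~ f`_i)) //; apply: eq_bigr => j _.
    rewrite {2}(orthonormal_expand he f`_i) sumE // mulr_sumr.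
    by apply: eq_bigr => l _; rewrite !mxE mulrA.
  by rewrite exchange_big; apply: eq_bigr => j _; rewrite exchange_big.
apply: eq_bigr => j _.
have QE l : \sum_i Q i j * Q i l = (j == l)%:R.
  have /matrixP/(_ j l) := QtQ; rewrite !mxE => <-.
  by apply: eq_bigr => i _; rewrite !mxE.
under eq_bigr => l _ do rewrite -mulr_suml QE.
rewrite (bigD1 j) //= eqxx mul1r big1 ?addr0 // => l.
by rewrite eq_sym => /negPf ->; rewrite mul0r.
Qed.

(** The operator's matrix in [vbasis {:V}] is conjugate to [H], so both have the same characteristic
    polynomial. *)
Lemma char_coef_mixed (h : {biscalar V}) (e : n.-tuple V) k :
  orthonormal g e -> (k <= n)%N ->
  char_coef g h k =
  \sum_(S : {set 'I_n} | #|S| == k) \det (mixed_mx S (\matrix_(i, j) h e`_i e`_j)).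
Proof.
move=> he kn; set H := \matrix_(i, j) _.
pose vb := vbasis {:V}; have vbB : basis_of {:V} vb := vbasisP _.
have eB := orthonormal_basis he.
pose P := passmx.mxof e vb \1%VF; pose P' := passmx.mxof vb e \1%VF.
have PP' : P *m P' = 1%:M.
  by rewrite -passmx.mxof_comp // comp_lfun1l passmx.mxof1 // (basis_free eB).
(* Row [i] of [mxof] holds the coordinates of the image of [e_i], which gives [H] and not its
   transpose. *)
have HE : passmx.mxof e e (bar_op g h) = H.
  apply/matrixP=> i j; rewrite !mxE /= passmx.vecof_delta.
  by rewrite (coord_orthonormal he) bar_opP.
have PA : P *m op_mx (bar_op g h) = H *m P.
  by rewrite -HE -!passmx.mxof_comp // comp_lfun1l comp_lfun1r.
rewrite /char_coef /op_char.
have -> : \det (map_mx polyC (op_mx (bar_op g h)) - 'X%:M) =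
    \det (map_mx polyC H - 'X%:M).
  have PpP' : map_mx polyC P *m map_mx polyC P' = 1%:M by rewrite -map_mxM PP' map_mx1.
  have detP : \det (map_mx polyC P) * \det (map_mx polyC P') = 1.
    by rewrite -det_mulmx PpP' det1.
  (* Multiplying both sides by [\det P * \det P'], which is 1, reduces the claim to the intertwining
     relation [PA]. *)
  rewrite -[LHS]mul1r -[RHS]mul1r -{1}detP -{1}detP -!mulrA ![\det (map_mx _ P') * _]mulrC !mulrA.
  congr (_ * _); rewrite -det_mulmx [RHS]mulrC -det_mulmx; congr (\det _).
  by rewrite mulmxBr mulmxBl -!map_mxM PA scalar_mxC.
by rewrite coef_det_subX // signrMK.
Qed.

End Orthonormal.

Theorem proposition2p7 (R : realType) (V : vectType R) (g : {dot V for idfun})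
    (h : {biscalar V}) (k : nat) (hk : (k < \dim {:V})%N)
    (e f : (\dim {:V}).-tuple V) (he : orthonormal g e) (hf : orthonormal g f) :
  contraction f (t_form g e h hk) = (\dim {:V} - k)%:R * char_coef g h k.
Proof.
(* The contraction moves from [f] to [e], so that it and the star use the same basis. *)
rewrite (contraction_orthonormal _ he hf) (char_coef_mixed h he (ltnW hk)).
set H := \matrix_(i, j) _; set a := ((\dim {:V}).-1 - k)%N.
have hodgeE (mn : (1 + (a + k))%N = \dim {:V}) (i : 'I_(\dim {:V})) I :
    hodge_coord g e mn [ffun=> e`_i] I = \det (star_mx R mn i I).
  congr (\det _); apply/matrixP=> r c; rewrite !mxE !ffunE.
  by case: split => b; rewrite !ffunE (orthonormal_nth he).
have WE (I J : {ffun 'I_(a + k) -> 'I_(\dim {:V})}) :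
    dmul (dpow (dform_of_bilin g) a) (dpow (dform_of_bilin h) k)
      (basis_args e I) (basis_args e J) = mixed_sum H I J.
  rewrite (dmul_gram (dpow_bilin g (k := a)) (dpow_bilin h (k := k))).
  apply: eq_bigr => s _; congr (_ * \det _); apply/matrixP=> r c.
  by rewrite !mxE !ffunE; case: ifP => _ //; apply: (orthonormal_nth he).
rewrite /contraction /= /dstar_fun -mulr_sumr.
rewrite [X in _ * X](_ : _ = (\sum_(S : {set 'I_(\dim {:V})} | #|S| == k)
    \det (mixed_mx S H)) *+ ((\dim {:V} - k) * (a`! * k`!))); last first.
  rewrite -(trace_star_mx (t_form_degree hk) H).
  apply: eq_bigr => i _; apply: eq_bigr => I _; apply: eq_bigr => J _.
  by rewrite !hodgeE WE.
(* The factorials produced by the mixed minors cancel the normalisation of [t_form]. *)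
rewrite -/a [(a`! * _)%N]mulnC -[X in _ * X = _]mulr_natl (natrM _ (_ - _)%N).
have fN0 : (k`! * a`!)%:R != 0 :> R by rewrite pnatr_eq0 -lt0n muln_gt0 !fact_gt0.
by rewrite -mulrA mulrCA mulKf.
Qed.
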